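(* For every $\varepsilon>0$ there exist constants $p_0=p_0(\varepsilon)$ and $c=c(\varepsilon)>0$, depending only on $\varepsilon$, such that for every prime $p\ge p_0$, every integer $M$ with $1\le M\le p$, every integer $\lambda$ with $\gcd(\lambda,p)=1$, and all integers $K,L$, the following hold: $$I_2(M;K,L)< c\left(\frac{M^{4/3+\varepsilon}}{p^{1/3}}+M^{\varepsilon}\right),$$ and, in the case $K=L$, $$I_2(M;L,L)< c\left(\frac{M^{3/2+\varepsilon}}{p^{1/2}}+M^{\varepsilon}\right).$$
   Context: For a prime $p$, integers $K,L,\lambda$ with $\gcd(\lambda,p)=1$ and an integer $1\le M\le p$, $I_2(M;K,L)$ denotes the number of pairs of integers $(x,y)$ with $xy\equiv\lambda\pmod p$, $K+1\le x\le K+M$, $L+1\le y\le L+M$. *)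

(* Defs.v *)
From HB Require Import structures.
From mathcomp Require Import all_boot all_order all_algebra.
From mathcomp Require Import finmap.
From mathcomp Require Import all_classical all_reals all_analysis.

Set Implicit Arguments.
Unset Strict Implicit.
Unset Printing Implicit Defensive.

Import Order.TTheory GRing.Theory Num.Theory.

Local Open Scope classical_set_scope.
Local Open Scope ring_scope.

Definition hyperbola_points (p : nat) (lambda : int) (M : nat) (K L : int) :
    set (int * int) :=
  [set xy | [/\ (xy.1 * xy.2 = lambda %[mod p%:Z])%Z,
                K + 1 <= xy.1 <= K + M%:Z
              & L + 1 <= xy.2 <= L + M%:Z]].

(* [fset_set] sends infinite sets to the empty one, so the cardinal in [I2]
   is the intended count only because of this fact. *)
Lemma hyperbola_points_finite (p : nat) (lambda : int) (M : nat) (K L : int) :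
  finite_set (hyperbola_points p lambda M K L).
Proof.
pose f (ij : 'I_M * 'I_M) := (K + 1 + ij.1%:Z, L + 1 + ij.2%:Z) : int * int.
apply: (@sub_finite_set _ _ (f @` setT)); last exact/finite_image/finite_finset.
have aux (a x : int) : a + 1 <= x <= a + M%:Z ->
    exists i : 'I_M, a + 1 + i%:Z = x.
  case/andP; rewrite -subr_ge0 => x_ge x_le.
  have xE : (absz (x - (a + 1))%R : int) = x - (a + 1) by rewrite gez0_abs.
  have ltM : (absz (x - (a + 1))%R < M)%N.
    by rewrite -ltz_nat xE ltrBlDl addrAC ltzD1.
  by exists (Ordinal ltM); rewrite /= xE addrC subrK.
move=> [x y] [_ /= /aux[i <-] /aux[j <-]].
by exists (i, j).
Qed.

Definition I2 (p : nat) (lambda : int) (M : nat) (K L : int) : nat :=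
  #|` fset_set (hyperbola_points p lambda M K L)|%fset.

(* Main.v *)
Require Import Defs.
From HB Require Import structures.
From mathcomp Require Import all_boot all_order all_algebra.
From mathcomp Require Import all_classical all_reals all_analysis.
From mathcomp Require Import finmap zify ring lra.

(** Translate by a known solution (x0, y0): the others satisfy
    x y + y0 x + x0 y = 0 mod p with |x|, |y| < M.

    If 4 M^4 < p, eliminating x0 and y0 by means of two further solutions gives
    a congruence between integers smaller than p, hence an equation over the
    integers, of the form (A x + b) (A y + d) = n with 0 < |n| <= M^6.

    If p <= 4 M^4, pigeonhole gives t such that t x0 = v and t y0 = u mod p with
    u, v = O(p/T), where T is about (p/M)^(1/k); here t <= T^2 and k = 3 in
    general, while t <= T and k = 2 when K = L, because x0 and y0 are then close
    to the same L.  Then t x y + u x + v y = p z with z = O(M/T), that is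
    (t x + v) (t y + u) = t p z + u v, whose right-hand side is O(p^2).

    In both cases the divisor bound d(n) <= C n^delta counts the solutions, and
    n is at most a power of M. *)

Set Implicit Arguments.
Unset Strict Implicit.
Unset Printing Implicit Defensive.

Import Order.TTheory GRing.Theory Num.Theory.

Local Open Scope ring_scope.

(** * Divisor counts and factorizations of an integer *)

(** A divisor [d] of [m * n] splits as [g * (d / g)] with [g = gcdn d m]; since [d / g] is coprime
    to [m / g], it divides [n]. *)
Lemma size_divisorsM (m n : nat) : (0 < m)%N -> (0 < n)%N ->
  (size (divisors (m * n)) <= size (divisors m) * size (divisors n))%N.
Proof.
move=> m_gt0 n_gt0; rewrite -(size_allpairs muln).
apply: (@uniq_leq_size _ _ [seq (a * b)%N | a <- divisors m, b <- divisors n]).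
  exact: divisors_uniq.
move=> d; rewrite -dvdn_divisors ?muln_gt0 ?m_gt0// => d_dvd.
have d_gt0 : (0 < d)%N by apply: dvdn_gt0 d_dvd; rewrite muln_gt0 m_gt0.
have g_gt0 : (0 < gcdn d m)%N by rewrite gcdn_gt0 d_gt0.
apply/allpairsP; exists (gcdn d m, d %/ gcdn d m)%N; split => /=.
- by rewrite -dvdn_divisors// dvdn_gcdr.
- have dK := divnK (dvdn_gcdl d m); have mK := divnK (dvdn_gcdr d m).
  have co : coprime (d %/ gcdn d m) (m %/ gcdn d m).
    by rewrite /coprime -(eqn_pmul2r g_gt0) muln_gcdl mul1n dK mK.
  rewrite -dvdn_divisors// -(Gauss_dvdr _ co) -(dvdn_pmul2r g_gt0) dK.
  by rewrite mulnAC mK.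
- by rewrite mulnC divnK// dvdn_gcdl.
Qed.

Lemma size_divisors_primeX (q a : nat) : prime q ->
  (size (divisors (q ^ a)) <= a.+1)%N.
Proof.
move=> q_pr; rewrite -[leqRHS](size_iota 0) -[leqRHS](size_map (expn q)).
apply: uniq_leq_size; first exact: divisors_uniq.
move=> d; rewrite -dvdn_divisors ?expn_gt0 ?prime_gt0//.
move=> /(dvdn_pfactor _ _ q_pr)[i ia ->].
by apply/map_f; rewrite mem_iota.
Qed.

Lemma size_divisors_part (q n : nat) : prime q -> (0 < n)%N ->
  (size (divisors n) <= (logn q n).+1 * size (divisors n`_(q^')))%N.
Proof.
move=> q_pr n_gt0; rewrite -{1}(partnC q n_gt0).
apply: leq_trans (size_divisorsM (part_gt0 _ _) (part_gt0 _ _)) _.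
by rewrite leq_mul2r p_part size_divisors_primeX ?orbT.
Qed.

Lemma size_le_fibers (T : eqType) (s : seq T) (f : T -> nat) (m k : nat) :
  {in s, forall x, (f x < m)%N} ->
  (forall j, (size [seq x <- s | f x == j] <= k)%N) -> (size s <= m * k)%N.
Proof.
elim: m s => [|m IHm] s f_lt fib.
  by case: s f_lt {fib} => // x s /(_ x); rewrite inE eqxx => /(_ isT).
rewrite -(count_predC (fun x => f x == m)) mulSn leq_add//.
  by rewrite -size_filter fib.
rewrite -size_filter; apply: IHm => [x|j].
  by rewrite mem_filter /= => /andP[fxm /f_lt]; rewrite ltnS leq_eqVlt (negPf fxm).
apply: leq_trans (fib j); rewrite -filter_predI !size_filter.
by apply: sub_count => x /= /andP[].
Qed.

(** The factor [a x + b] is, up to sign, a divisor of [n]; as [n != 0] it determines the other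
    factor, and nonzero [a], [c] then give back [x] and [y]. *)
Lemma size_factorizations (s : seq (int * int)) (a b c d n : int) :
  uniq s -> a != 0 -> c != 0 -> n != 0 ->
  {in s, forall P, (a * P.1 + b) * (c * P.2 + d) = n} ->
  (size s <= 2 * size (divisors `|n|))%N.
Proof.
move=> s_uniq a0 c0 n0 sP.
pose div := [seq k%:Z | k <- divisors `|n|] ++ [seq - k%:Z | k <- divisors `|n|].
have -> : (2 * size (divisors `|n|))%N = size div.
  by rewrite size_cat !size_map mul2n addnn.
rewrite -(size_map (fun P => a * P.1 + b)); apply: uniq_leq_size.
  rewrite map_inj_in_uniq// => -[x y] [x' y'] /sP /= e /sP /= e' eq.
  have nz : a * x + b != 0 by apply: contraNneq n0 => h; rewrite -e h mul0r.
  have /(mulfI nz) : (a * x + b) * (c * y + d) = (a * x + b) * (c * y' + d).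
    by rewrite e eq e'.
  by move=> /addIr/(mulfI c0) ->; move: eq => /addIr/(mulfI a0) ->.
move=> _ /mapP[P /sP e ->].
have mem : `|(a * P.1 + b)%R|%N \in divisors `|n|.
  by rewrite -dvdn_divisors ?absz_gt0// -e abszM dvdn_mulr.
rewrite mem_cat; apply/orP.
have [h|h] := leP 0 (a * P.1 + b); [left|right].
  by apply/mapP; exists `|(a * P.1 + b)%R|%N => //; rewrite gez0_abs.
by apply/mapP; exists `|(a * P.1 + b)%R|%N => //; rewrite ltz0_abs ?opprK.
Qed.

(** * Simultaneous approximation by pigeonhole *)

(** Among the multiples [k a] with [0 <= k <= T ^ #|I|], two have their residues mod [p] in the same
    box of side [p / T]; [t] is the difference of the two multipliers. *)
Lemma dirichlet_approximation (I : finType) (a : I -> int) (p T : nat) :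
  (0 < p)%N -> (0 < T)%N ->
  exists t : nat, (0 < t <= T ^ #|I|)%N /\
    forall i, exists2 u : int, (p %| t%:Z * a i - u)%Z & `|u| * T%:Z <= p%:Z.
Proof.
move=> p_gt0 T_gt0.
have p0 : p%:Z != 0 by lia.
pose r (k : nat) i := (k%:Z * a i %% p)%Z.
have r_ge0 k i : 0 <= r k i by rewrite modz_ge0.
have r_lt k i : r k i < p%:Z by rewrite ltz_pmod; lia.
have box_lt k i : (`|r k i| * T %/ p < T)%N.
  by rewrite ltn_divLR// mulnC ltn_mul2l T_gt0; have := r_ge0 k i; have := r_lt k i; lia.
pose box (k : 'I_(T ^ #|I|).+1) := [ffun i => Ordinal (box_lt k i)].
have /injectivePn[j [k jk ejk]] : ~~ injectiveb box.
  apply/injectiveP => /leq_card; rewrite card_ord card_ffun card_ord.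
  by rewrite ltnn.
wlog lt_jk : j k jk ejk / (j < k)%N.
  move=> wl; have [h|h|/val_inj h] := ltngtP j k; first exact: (wl j k).
    by apply: (wl k j) => //; rewrite eq_sym.
  by rewrite h eqxx in jk.
exists (k - j)%N; split; first by have := ltn_ord k; lia.
move=> i; exists (r k i - r j i).
  have e l : l%:Z * a i = (l%:Z * a i %/ p)%Z * p + r l i by exact: divz_eq.
  rewrite -subzn 1?ltnW// mulrBl (e k) (e j).
  by apply/dvdzP; exists ((k%:Z * a i %/ p)%Z - (j%:Z * a i %/ p)%Z); ring.
(* Both residues times [T] have the same quotient by [p], so these products differ by less than
   [p]. *)
have /(congr1 val) := congr1 (fun f : {ffun I -> 'I_T} => f i) ejk.
rewrite !ffunE /=; move: (r_ge0 j i) (r_ge0 k i).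
have := divn_eq (`|r j i| * T) p; have := divn_eq (`|r k i| * T) p.
have := ltn_pmod (`|r j i| * T) p_gt0; have := ltn_pmod (`|r k i| * T) p_gt0.
case: (r j i) (r k i) => [a'|?] [b'|?]//=.
move: (_ %% _)%N (_ %% _)%N (_ %/ _)%N (_ %/ _)%N => q1 q2 q3 q4 lt1 lt2 e1 e2 _ _ e3.
rewrite -{1}[T%:Z]gez0_abs// -normrM mulrBl.
have -> : b'%:Z * T = (b' * T)%N by [].
have -> : a'%:Z * T = (a' * T)%N by [].
by rewrite e1 e2 e3; lia.
Qed.

(** * Divisibility and norm estimates *)

Lemma dvdz_lt_eq0 (d z : int) : (d %| z)%Z -> `|z| < `|d| -> z = 0.
Proof.
case: (eqVneq z 0) => // z0 /(dvdn_leq _); rewrite absz_gt0 z0 => /(_ isT).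
by rewrite -lez_nat !abszE leNgt => /negbTE ->.
Qed.

Lemma dvdz_primeM (p : nat) (m n : int) : prime p ->
  (p %| m * n)%Z = (p %| m)%Z || (p %| n)%Z.
Proof. by move=> p_pr; rewrite !dvdzE abszM Euclid_dvdM. Qed.

Lemma ler_normM (R : numDomainType) (a b c d : R) :
  `|a| <= c -> `|b| <= d -> `|a * b| <= c * d.
Proof. by move=> ac bd; rewrite normrM ler_pM. Qed.

Lemma ler_normBD (R : numDomainType) (a b c d : R) :
  `|a| <= c -> `|b| <= d -> `|a - b| <= c + d.
Proof. by move=> ac bd; apply: le_trans (ler_normB _ _) (lerD _ _). Qed.

Lemma ler_normDD (R : numDomainType) (a b c d : R) :
  `|a| <= c -> `|b| <= d -> `|a + b| <= c + d.
Proof. by move=> ac bd; apply: le_trans (ler_normD _ _) (lerD _ _). Qed.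

Lemma size_uniq_le1 (T : eqType) (s : seq T) :
  uniq s -> {in s &, forall x y, x = y} -> (size s <= 1)%N.
Proof.
case: s => [|x [|y s]]//= /andP[xs _] /(_ x y); rewrite !inE !eqxx orbT => h.
by rewrite h// !inE eqxx in xs.
Qed.

(** * Solutions of the congruence in a box *)

Section Hyperbola.

Variables (p M : nat) (lambda K L : int).
Hypotheses (p_pr : prime p) (le_Mp : (M <= p)%N) (co_lp : coprimez lambda p%:Z).

Local Notation point := (hyperbola_points p lambda M K L).

Lemma hyperbola_unit (P : int * int) : point P ->
  ~~ (p %| P.1)%Z /\ ~~ (p %| P.2)%Z.
Proof.
case: P => x y [/= /eqP xy _ _].
suff : ~~ (p %| x * y)%Z by rewrite dvdz_primeM// negb_or => /andP.
apply: contraL co_lp => p_xy; rewrite eqz_mod_dvd in xy.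
have p_l : (p %| lambda)%Z by rewrite -(subKr (x * y) lambda) rpredB.
apply: contraTN (prime_gt1 p_pr) => co; rewrite -leqNgt; apply: dvdn_leq => //.
by move: co; rewrite coprimezE /coprime => /eqP <-; rewrite dvdn_gcd dvdnn andbT.
Qed.

Lemma hyperbola_translate (P0 P : int * int) : point P0 -> point P ->
  (p %| (P.1 - P0.1) * (P.2 - P0.2) + P0.2 * (P.1 - P0.1)
        + P0.1 * (P.2 - P0.2))%Z.
Proof.
case: P0 P => x0 y0 [x y] [/= e0 _ _] [/= e _ _].
have /eqP := etrans e (esym e0); rewrite eqz_mod_dvd.
by congr (_ %| _)%Z; ring.
Qed.

Lemma hyperbola_dist (P Q : int * int) : point P -> point Q ->
  `|P.1 - Q.1| < M%:Z /\ `|P.2 - Q.2| < M%:Z.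
Proof. by case: P Q => x y [x' y'] [/= _ ? ?] [/= _ ? ?]; lia. Qed.

(** The translated congruence reduces to [p] dividing [Q.1 * (P.2 - Q.2)]; here [Q.1] is a unit mod
    [p] and the difference is smaller than [M <= p]. *)
Lemma hyperbola_inj1 (P Q : int * int) : point P -> point Q ->
  P.1 = Q.1 -> P = Q.
Proof.
move=> hP hQ e; have [_ dist] := hyperbola_dist hP hQ.
have := hyperbola_translate hQ hP; rewrite e subrr mul0r mulr0 !add0r.
rewrite dvdz_primeM// (negPf (proj1 (hyperbola_unit hQ))) /= => /dvdz_lt_eq0 h.
have /eqP : P.2 - Q.2 = 0 by apply: h; lia.
by case: P Q e {hP hQ dist h} => x y [x' y'] /= -> ; rewrite subr_eq0 => /eqP ->.
Qed.

Lemma hyperbola_inj2 (P Q : int * int) : point P -> point Q ->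
  P.2 = Q.2 -> P = Q.
Proof.
move=> hP hQ e; have [dist _] := hyperbola_dist hP hQ.
have := hyperbola_translate hQ hP; rewrite e subrr !mulr0 add0r addr0.
rewrite dvdz_primeM// (negPf (proj2 (hyperbola_unit hQ))) /= => /dvdz_lt_eq0 h.
have /eqP : P.1 - Q.1 = 0 by apply: h; lia.
by case: P Q e {hP hQ dist h} => x y [x' y'] /= -> ; rewrite subr_eq0 => /eqP ->.
Qed.

(** The elimination needs three distinct solutions, so lists of at most two form a separate case. *)
Lemma small_box_size (s : seq (int * int)) :
  (4 * M ^ 4 < p)%N -> uniq s -> {in s, forall P, point P} ->
  (size s <= 2)%N \/ exists2 n : nat, (0 < n <= M ^ 6)%N &
    (size s <= 2 * size (divisors n))%N.
Proof.
move=> M_small; case: s => [|P0 [|P1 [|P2 s']]]; try by left.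
set s := P0 :: _ => s_uniq sP; right.
have h0 : point P0 by apply: sP; rewrite !inE eqxx.
have h1 : point P1 by apply: sP; rewrite !inE eqxx ?orbT.
have h2 : point P2 by apply: sP; rewrite !inE eqxx ?orbT.
have [n01 n02 n12] : [/\ P0 <> P1, P0 <> P2 & P1 <> P2].
  by split => e; move: s_uniq; rewrite /s e /= !inE eqxx ?orbT ?andbF.
set x0 := P0.1; set y0 := P0.2.
pose x1 := P1.1 - x0; pose y1 := P1.2 - y0.
pose x2 := P2.1 - x0; pose y2 := P2.2 - y0.
have [x1M y1M] : `|x1| < M%:Z /\ `|y1| < M%:Z := hyperbola_dist h1 h0.
have [x2M y2M] : `|x2| < M%:Z /\ `|y2| < M%:Z := hyperbola_dist h2 h0.
have [dxM dyM] : `|x2 - x1| < M%:Z /\ `|y2 - y1| < M%:Z.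
  have [] := hyperbola_dist h2 h1.
  have -> : x2 - x1 = P2.1 - P1.1 by rewrite /x2 /x1; ring.
  by have -> : y2 - y1 = P2.2 - P1.2 by rewrite /y2 /y1; ring.
have x1_neq0 : x1 != 0 by rewrite subr_eq0; apply/eqP => /(hyperbola_inj1 h1 h0) /esym.
have y1_neq0 : y1 != 0 by rewrite subr_eq0; apply/eqP => /(hyperbola_inj2 h1 h0) /esym.
have y2_neq0 : y2 != 0 by rewrite subr_eq0; apply/eqP => /(hyperbola_inj2 h2 h0) /esym.
have x2_neq0 : x2 != 0 by rewrite subr_eq0; apply/eqP => /(hyperbola_inj1 h2 h0) /esym.
have dx_neq0 : x2 - x1 != 0.
  by apply/eqP => /subr0_eq/addIr/esym /(hyperbola_inj1 h1 h2).
have dy_neq0 : y2 - y1 != 0.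
  by apply/eqP => /subr0_eq/addIr/esym /(hyperbola_inj2 h1 h2).
(* These are the coefficients at [P2] once [x0] is eliminated: [B y1 + A y0] is divisible by [p]. *)
pose A := x2 * y1 - x1 * y2; pose B := y2 * (x2 - x1).
(* Combining the congruences of [P] and [P1] cancels [x0]. *)
have rel P : point P ->
    (p %| (P.2 - y0) * y1 * (P.1 - x0 - x1)
          + y0 * ((P.1 - x0) * y1 - x1 * (P.2 - y0)))%Z.
  move=> hP; have h := rpredB (dvdz_mull y1 (hyperbola_translate h0 hP))
    (dvdz_mull (P.2 - y0) (hyperbola_translate h0 h1)).
  by apply: etrans h; congr (_ %| _)%Z; rewrite -/x0 -/y0 -/x1 -/y1; ring.
have p_y1 : ~~ (p %| y1)%Z.
  by apply: contra_neqN y1_neq0 => /dvdz_lt_eq0; apply; lia.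
have le_AM : `|A| <= M%:Z * M%:Z + M%:Z * M%:Z.
  by rewrite ler_normBD// ler_normM// ltW.
have le_BM : `|B| <= M%:Z * M%:Z := ler_normM (ltW y2M) (ltW dxM).
have B_neq0 : B != 0 by rewrite mulf_neq0.
(* If [A = 0], the relation at [P2] makes [p] divide [y2 * y1 * (x2 - x1)], whose factors are
   nonzero and smaller than [p]. *)
have A_neq0 : A != 0.
  apply/eqP => A0; have := rel _ h2; rewrite -/x2 -/y2 -/A A0 mulr0 addr0.
  rewrite !dvdz_primeM// (negPf p_y1) orbF.
  by case/orP=> /dvdz_lt_eq0 z0; [case/eqP: y2_neq0|case/eqP: dx_neq0]; apply: z0; lia.
(* The factored form shows that [A - B] is nonzero and at most [M^2] in absolute value. *)
have AB : A - B = - (x2 * (y2 - y1)) by rewrite /A /B; ring.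
(* Eliminate [y0] between the relations at [P] and [P2], then cancel [y1]. Each side is at most
   [2 M^4] in absolute value, so [4 M^4 < p] turns the congruence into an equality. *)
have key P : point P -> A * (P.2 - y0) * (P.1 - x0 - x1)
    = B * ((P.1 - x0) * y1 - x1 * (P.2 - y0)).
  move=> hP; apply/subr0_eq.
  have [xM yM] : `|P.1 - x0| < M%:Z /\ `|P.2 - y0| < M%:Z := hyperbola_dist hP h0.
  have [dM _] := hyperbola_dist hP h1.
  have e : P.1 - x0 - x1 = P.1 - P1.1 by rewrite /x1; ring.
  apply: (@dvdz_lt_eq0 p%:Z).
    have := rpredB (dvdz_mull A (rel _ hP))
      (dvdz_mull ((P.1 - x0) * y1 - x1 * (P.2 - y0)) (rel _ h2)).
    rewrite -/x2 -/y2 => h.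
    have : (p %| y1 * (A * (P.2 - y0) * (P.1 - x0 - x1) -
       B * ((P.1 - x0) * y1 - x1 * (P.2 - y0))))%Z.
      by apply: etrans h; congr (_ %| _)%Z; rewrite /B /A; ring.
    by rewrite dvdz_primeM// (negPf p_y1).
  have le3 : `|(P.1 - x0) * y1 - x1 * (P.2 - y0)| <= M%:Z * M%:Z + M%:Z * M%:Z.
    by rewrite ler_normBD// ler_normM// ltW.
  rewrite e; apply: le_lt_trans
    (ler_normBD (ler_normM (ler_normM le_AM (ltW yM)) (ltW dM)) (ler_normM le_BM le3)) _.
  by move: M_small; clear; lia.
(* Multiplying [key] by [A] and completing the product leaves this constant. *)
pose n := B * x1 * y1 * (A - B).
have n_neq0 : n != 0 by rewrite /n AB mulrN oppr_eq0; do ![apply: mulf_neq0].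
exists `|n|%N.
  rewrite absz_gt0 n_neq0 /= -lez_nat abszE.
  have le3 : `|A - B| <= M%:Z * M%:Z by rewrite AB normrN (ler_normM (ltW _) (ltW _)).
  apply: le_trans (ler_normM (ler_normM (ler_normM le_BM (ltW x1M)) (ltW y1M)) le3) _.
  by clear; lia.
apply: (@size_factorizations _ A (B * x1 - A * x1 - A * x0)
  A (- (B * y1) - A * y0)) => //.
move=> P /sP /key/eqP; rewrite -subr_eq0 => /eqP hP; apply: subr0_eq.
transitivity (A * 0); last exact: mulr0.
by rewrite -hP /n; ring.
Qed.

(** The quotient [z] takes at most [2 Z + 1] values, where [Z] is the integer part of [5 M / T].
    Each value leaves at most [2 D] points if [n != 0] and at most 2 if [n = 0]; the factor
    [2 D + 2] covers both. *)
Lemma large_box_size (s : seq (int * int)) (P0 : int * int) (t T D : nat) (u v : int) :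
  uniq s -> {in s, forall P, point P} -> point P0 ->
  (0 < t)%N -> (0 < T)%N -> (t * T * M <= p)%N ->
  (p %| t%:Z * P0.1 - v)%Z -> `|v| * T%:Z <= 2 * p%:Z ->
  (p %| t%:Z * P0.2 - u)%Z -> `|u| * T%:Z <= 2 * p%:Z ->
  (forall n, 0 < n <= 9 * p ^ 2 -> size (divisors n) <= D)%N ->
  (size s <= (5 * M %/ T * 2 + 1) * (2 * D + 2))%N.
Proof.
move=> s_uniq sP h0 t_gt0 T_gt0 tTM dv vT du uT leD.
have p_gt0 := prime_gt0 p_pr.
set x0 := P0.1 in dv; set y0 := P0.2 in du.
(* This is [t] times the translated congruence, with [t x0] and [t y0] replaced by [v] and [u]. *)
pose E (P : int * int) := t%:Z * ((P.1 - x0) * (P.2 - y0))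
  + u * (P.1 - x0) + v * (P.2 - y0).
have pE P : point P -> (p %| E P)%Z.
  move=> hP; have h := rpredB (rpredB (dvdz_mull t%:Z (hyperbola_translate h0 hP))
    (dvdz_mull (P.1 - x0) du)) (dvdz_mull (P.2 - y0) dv).
  by apply: etrans h; congr (_ %| _)%Z; rewrite /E -/x0 -/y0; ring.
pose z P := (E P %/ p)%Z; pose Z := (5 * M %/ T)%N.
have zE P : point P -> E P = z P * p%:Z by move=> /pE /divzK.
have le_zZ P : point P -> `|z P| <= Z%:Z.
  move=> hP; have [xM yM] := hyperbola_dist hP h0.
  suff : `|z P| * T%:Z <= 5 * M%:Z.
    by move=> h; rewrite -abszE lez_nat leq_divRL// -lez_nat.
  have p0 : 0 < p%:Z by [].
  rewrite -(ler_pM2r p0).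
  (* Times [T], the three terms of [E P] are at most [p M], [2 p M] and [2 p M]; the first uses
     [t T M <= p]. *)
  have tTM' : `|t%:Z * T%:Z * (P.1 - x0)| <= p%:Z.
    by apply: le_trans (ler_normM (lexx _) (ltW xM)) _; rewrite -PoszM ger0_norm.
  have uT' : `|u * T%:Z| <= 2 * p%:Z by rewrite normrM.
  have vT' : `|v * T%:Z| <= 2 * p%:Z by rewrite normrM.
  have le5 := ler_normDD (ler_normDD (ler_normM tTM' (ltW yM)) (ler_normM uT' (ltW xM)))
    (ler_normM vT' (ltW yM)).
  have -> : `|z P| * T%:Z * p%:Z = `|E P * T%:Z|.
    by rewrite zE// !normrM mulrAC.
  apply: le_trans (_ : p%:Z * M%:Z + 2 * p%:Z * M%:Z + 2 * p%:Z * M%:Z <= _);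
    last by clear; lia.
  by apply: etrans le5; congr (`|_| <= _); rewrite /E; ring.
(* The shift by [Z] turns [z] into a natural number below [2 Z + 1]. *)
pose f P := `|(z P + Z%:Z)%R|%N.
have z_ge P : point P -> (f P)%:Z = z P + Z%:Z.
  by move=> /le_zZ; rewrite /f; lia.
apply: (size_le_fibers (f := f)) => [P /sP hP|j].
  by have := le_zZ _ hP; have := z_ge _ hP; lia.
set s' := [seq P <- s | f P == j].
have s'_uniq : uniq s' by apply: filter_uniq.
(* With [X], [Y] the translated coordinates, [(t X + v) (t Y + u) = t E + u v], and [E = (j - Z) p]
   on this fibre. *)
pose n := t%:Z * ((j%:Z - Z%:Z) * p%:Z) + u * v.
have s'P : {in s', forall P, point P /\
    (t%:Z * P.1 + (v - t%:Z * x0)) * (t%:Z * P.2 + (u - t%:Z * y0)) = n}.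
  move=> P; rewrite mem_filter => /andP[/eqP fPj /sP hP]; split=> //.
  rewrite /n -fPj z_ge// addrK -zE// /E.
  by ring.
clearbody s'; have t_neq0 : t%:Z != 0 by lia.
have [n0|n_neq0] := eqVneq n 0.
  (* One of the two factors vanishes; either vanishing fixes a coordinate, hence the point. *)
  pose a (P : int * int) := t%:Z * P.1 + (v - t%:Z * x0) == 0.
  rewrite -(count_predC a) -!size_filter; apply: leq_trans (leq_addl _ _).
  apply: (@leq_add _ _ 1 1); apply: size_uniq_le1; rewrite ?filter_uniq// => P Q;
    rewrite !mem_filter => /andP[/= aP /s'P[hP eP]] /andP[/= aQ /s'P[hQ eQ]].
    apply: (hyperbola_inj1 hP hQ); apply/(mulfI t_neq0)/(addIr (v - t%:Z * x0)).
    by rewrite (eqP aP) (eqP aQ).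
  apply: (hyperbola_inj2 hP hQ); apply/(mulfI t_neq0)/(addIr (u - t%:Z * y0)).
  rewrite n0 in eP eQ.
  move: eP eQ => /eqP + /eqP; rewrite !mulf_eq0 -/(a P) -/(a Q) (negPf aP) (negPf aQ) /=.
  by move=> /eqP -> /eqP ->.
(* The size of [n] is read off at a point of the fibre, where each factor is at most [p + 2 p]. *)
have [s'0|[P Ps']] : s' = [::] \/ exists P, P \in s'.
  by case: (s') => [|P r]; [left|right; exists P; rewrite inE eqxx].
  by rewrite s'0.
have n_le : (`|n| <= 9 * p ^ 2)%N.
  have [hP <-] := s'P _ Ps'; have [xM yM] := hyperbola_dist hP h0.
  have le3 w r : `|w| <= M%:Z -> `|r| * T%:Z <= 2 * p%:Z ->
      `|t%:Z * w + r| <= 3 * p%:Z.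
    move=> wM rT.
    have r_le : `|r| <= 2 * p%:Z.
      by apply: le_trans rT; rewrite ler_peMr// (lez_nat 1 T).
    have tw_le : `|t%:Z * w| <= p%:Z.
      apply: le_trans (ler_normM (lexx _) wM) _; rewrite ger0_norm// -PoszM lez_nat.
      by apply: leq_trans tTM; rewrite mulnAC leq_pmulr.
    by apply: le_trans (ler_normDD tw_le r_le) _; clear; lia.
  have -> : t%:Z * P.1 + (v - t%:Z * x0) = t%:Z * (P.1 - x0) + v by ring.
  have -> : t%:Z * P.2 + (u - t%:Z * y0) = t%:Z * (P.2 - y0) + u by ring.
  have := ler_normM (le3 _ _ (ltW xM) vT) (le3 _ _ (ltW yM) uT).
  by rewrite -lez_nat abszE => h; apply: le_trans h _; clear; lia.
have fact := size_factorizations s'_uniq t_neq0 t_neq0 n_neq0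
  (fun P' Ps => proj2 (s'P P' Ps)).
apply: (leq_trans fact); apply: (@leq_trans (2 * D)); last exact: leq_addr.
by rewrite leq_mul2l leD// absz_gt0 n_neq0.
Qed.

End Hyperbola.

(** * The divisor bound *)

Lemma bernoulli_ge0 (R : realDomainType) (h : R) (a : nat) :
  0 <= h -> 1 + h *+ a <= (1 + h) ^+ a.
Proof.
move=> h_ge0; elim: a => [|a IHa]; first by rewrite mulr0n addr0.
rewrite exprS; apply: le_trans (ler_wpM2l _ IHa); last exact: addr_ge0.
have : 0 <= h * h *+ a by rewrite mulrn_wge0// mulr_ge0.
by rewrite mulrS mulrDl mul1r mulrDr mulr1 mulrnAr;
  move: (h *+ a) (h * h *+ a) => x y; lra.
Qed.

Lemma powRnatX (R : realType) (m k : nat) (x : R) :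
  (m ^ k)%:R `^ x = (m%:R `^ x) ^+ k.
Proof.
rewrite natrX -[m%:R ^+ k]powR_mulrn ?ler0n// powRAC.
by apply: powR_mulrn; apply: powR_ge0.
Qed.

Lemma size_divisors_le_powR (R : realType) (delta : R) : 0 < delta ->
  exists2 C : R, 1 <= C &
    forall n, (0 < n)%N -> (size (divisors n))%:R <= C * n%:R `^ delta.
Proof.
move=> delta_gt0.
have pow_mono : {homo (fun n : nat => n%:R `^ delta : R) : m n / (m <= n)%N >-> m <= n}.
  by move=> m n mn; rewrite ge0_ler_powR ?ler_nat ?nnegrE// ltW.
(* A prime q >= Q has q^(a delta) >= 2^a >= a + 1, so it contributes a factor
   at most 1; each of the finitely many smaller primes costs a constant C0. *)
pose Q := (Num.truncn (2 `^ delta^-1 : R)).+1.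
have Q_ge2 : 2 <= Q%:R `^ delta :> R.
  have e : (2 `^ delta^-1) `^ delta = 2 :> R.
    by rewrite -powRrM mulVf ?powRr1// gt_eqF.
  rewrite -[leLHS]e.
  by rewrite ge0_ler_powR ?nnegrE ?powR_ge0// ltW// truncnS_gt.
(* Splitting off the full power of a prime [q] from [n] costs a factor [C]. *)
have step (C b : R) (q n : nat) : prime q -> (0 < n)%N -> 0 <= C ->
    (size (divisors (n`_(q^'))%N))%:R <= b * (n`_(q^'))%N%:R `^ delta ->
    (logn q n).+1%:R <= C * (q%:R `^ delta) ^+ logn q n ->
    (size (divisors n))%:R <= C * b * n%:R `^ delta.
  move=> q_pr n_gt0 C_ge0 hb hC.
  have nE : n%:R `^ delta = (q%:R `^ delta) ^+ logn q n * (n`_(q^'))%N%:R `^ delta :> R.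
    by rewrite -{1}(partnC q n_gt0) natrM powRM// p_part powRnatX.
  have := size_divisors_part q_pr n_gt0.
  rewrite -(ler_nat R) natrM => /le_trans -> //.
  by apply: le_trans (ler_pM _ _ hC hb) _ => //; rewrite nE mulrACA.
have large n : (0 < n)%N -> (forall q, prime q -> q %| n -> Q <= q)%N ->
    (size (divisors n))%:R <= n%:R `^ delta.
  elim/ltn_ind: n => n IHn n_gt0 hn.
  have [|n_gt1] := leqP n 1.
    by case: n n_gt0 {IHn hn} => [|[|n]]// _ _; rewrite powR1.
  have q_pr := pdiv_prime n_gt1; set q := pdiv n in q_pr.
  have Qq : (Q <= q)%N by apply: hn (pdiv_dvd n).
  rewrite -[leRHS]mul1r -[X in X * _]mulr1; apply: (step _ _ q) => //.
    rewrite mul1r; apply: IHn; rewrite ?part_gt0//.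
      rewrite -{2}(partnC q n_gt0) ltn_Pmull ?part_gt0// p_part.
      by rewrite -[X in (X < _)%N](expn0 q) ltn_exp2l ?prime_gt1// logn_gt0
        mem_primes q_pr n_gt0 pdiv_dvd.
    by move=> r r_pr /dvdn_trans r_dvd; apply: hn => //; apply/r_dvd/dvdn_part.
  rewrite mul1r; apply: (@le_trans _ _ (2 ^+ logn q n)).
    by rewrite -natrX ler_nat ltn_expl.
  by rewrite lerXn2r ?nnegrE ?powR_ge0//; apply: le_trans Q_ge2 (pow_mono _ _ Qq).
pose h : R := 2 `^ delta - 1.
have h_gt0 : 0 < h.
  have e : 1 `^ delta = 1 :> R by rewrite powR1.
  by rewrite subr_gt0 -[ltLHS]e gt0_ltr_powR ?nnegrE ?ltr1n.
(* Bernoulli gives [q ^ (a delta) >= 1 + h a], and [(1 + 1/h) (1 + h a) = a + 1 + h a + 1/h]. *)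
pose C0 : R := 1 + h^-1.
have hV : 0 < h^-1 by rewrite invr_gt0.
have C0P q a : prime q -> a.+1%:R <= C0 * (q%:R `^ delta) ^+ a.
  move=> q_pr; apply: (@le_trans _ _ (C0 * (1 + h *+ a))).
    have ha : 0 <= h * a%:R by rewrite mulr_ge0// ltW.
    have -> : C0 * (1 + h *+ a) = a.+1%:R + (h * a%:R + h^-1).
      by rewrite /C0 -natr1 -mulr_natr; field; rewrite gt_eqF.
    by rewrite lerDl addr_ge0// ltW.
  rewrite ler_wpM2l//; first by rewrite /C0; lra.
  apply: le_trans (bernoulli_ge0 _ (ltW h_gt0)) _.
  rewrite lerXn2r ?nnegrE ?powR_ge0// /h addrC subrK ?powR_ge0//.
  by apply: (pow_mono 2); apply: prime_gt1.
(* Lower the threshold on prime factors from [Q] one unit at a time; at [i = Q] no restriction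
   remains. *)
suff descent i : exists2 C : R, 1 <= C & forall n, (0 < n)%N ->
    (forall q, prime q -> q %| n -> Q - i <= q)%N ->
    (size (divisors n))%:R <= C * n%:R `^ delta.
  have [C C_ge1 hC] := descent Q; exists C => // n n_gt0; apply: hC => // q _ _.
  by rewrite subnn.
elim: i => [|i [C C_ge1 IHi]].
  by exists 1 => // n n_gt0 hn; rewrite mul1r large// => q; rewrite -(subn0 Q); apply: hn.
exists (C0 * C) => [|n n_gt0 hn].
  by rewrite -[leLHS]mulr1 ler_pM// /C0; lra.
set q := (Q - i.+1)%N in hn *; have [q_pr|q_npr] := boolP (prime q).
  apply: (step _ _ q) => //; first by rewrite /C0; lra.
    apply: IHi => [|r r_pr r_dvd]; first exact: part_gt0.
    have : (q <= r)%N by apply: hn => //; apply: dvdn_trans r_dvd (dvdn_part _ _).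
    rewrite leq_eqVlt => /predU1P[qr|]; last by rewrite /q; lia.
    have /(pnatP _ (part_gt0 q^' n))/(_ r r_pr r_dvd) := part_pnat q^' n.
    by rewrite -qr !inE eqxx.
  exact: C0P.
have -> // : C0 * C * n%:R `^ delta = C0 * (C * n%:R `^ delta) by rewrite mulrA.
apply: le_trans (IHi _ n_gt0 _) _ => [r r_pr r_dvd|].
  have := hn _ r_pr r_dvd; rewrite leq_eqVlt => /predU1P[qr|]; last by rewrite /q; lia.
  by rewrite qr r_pr in q_npr.
rewrite ler_peMl// ?mulr_ge0 ?powR_ge0//; first exact: le_trans C_ge1.
by rewrite /C0; lra.
Qed.

(** * The parameter [T] and the bound over the reals *)

(** [T] is the integer part of [(p/M)^(1/k)]; the upper bound is maximality applied to [2 T > T]. *)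
Lemma root_floor (k M p : nat) : (0 < k)%N -> (0 < M <= p)%N ->
  exists2 T : nat, (0 < T)%N & (T ^ k * M <= p < (2 * T) ^ k * M)%N.
Proof.
move=> k_gt0 /andP[M_gt0 le_Mp].
have ex : exists T, (T ^ k * M <= p)%N by exists 1; rewrite exp1n mul1n.
have bnd T : (T ^ k * M <= p)%N -> (T <= p)%N.
  apply: leq_trans; case: T => // T; apply: leq_trans (leq_pmulr _ M_gt0).
  by rewrite -[X in (X <= _)%N]expn1 leq_pexp2l.
case: (ex_maxnP ex bnd) => T hT maxT.
have T_gt0 : (0 < T)%N by apply: maxT; rewrite exp1n mul1n.
exists T => //; rewrite hT ltnNge; apply/negP => /maxT.
by rewrite mul2n -addnn -{3}[T]addn0 leq_add2l leqNgt T_gt0.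
Qed.

Lemma I2_size (p M : nat) (lambda K L : int) :
  exists s, [/\ uniq s, {in s, forall P, hyperbola_points p lambda M K L P}
    & I2 p lambda M K L = size s].
Proof.
exists (enum_fset (fset_set (hyperbola_points p lambda M K L))); split => //.
  exact: fset_uniq.
by move=> P; rewrite in_fset_set => [/set_mem|]; last exact: hyperbola_points_finite.
Qed.

(** The bound [2 p], twice what pigeonhole gives, leaves room for the shift from [L] to a coordinate
    when [K = L]. *)
Definition linearizing (p M : nat) (P0 : int * int) (T : nat) : Prop :=
  exists (t : nat) (u v : int), [/\ (0 < t)%N, (t * T * M <= p)%N,
    (p %| t%:Z * P0.1 - v)%Z /\ `|v| * T%:Z <= 2 * p%:Z
    & (p %| t%:Z * P0.2 - u)%Z /\ `|u| * T%:Z <= 2 * p%:Z].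

(** Both bounds of the theorem are instances, with [k = 3] and [k = 2]; [c] is chosen before [k], so
    one constant serves both. *)
Lemma I2_lt_of_linearizing (R : realType) (eps : R) : 0 < eps ->
  exists2 c : R, 0 < c & forall (p M : nat) (lambda K L : int) (k T : nat),
    prime p -> (0 < M <= p)%N -> coprimez lambda p%:Z ->
    (0 < k)%N -> (0 < T)%N -> (p < (2 * T) ^ k * M)%N ->
    (forall P0, hyperbola_points p lambda M K L P0 -> linearizing p M P0 T) ->
    (I2 p lambda M K L)%:R <
      c * (M%:R `^ (1 + k%:R^-1 + eps) / p%:R `^ k%:R^-1 + M%:R `^ eps).
Proof.
move=> eps_gt0; have delta_gt0 : 0 < eps / 8 by lra.
have [C C_ge1 hC] := size_divisors_le_powR delta_gt0.
pose G : R := 144 `^ (eps / 8).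
have G_ge1 : 1 <= G by rewrite -(powRr0 144) ler_powR ?ler1n// ltW.
pose E := 2 * (C * G) + 2.
have CG_ge1 : 1 <= C * G by rewrite -[leLHS]mulr1 ler_pM.
exists (20 * E + 1); first by rewrite /E; lra.
move=> p M lambda K L k T p_pr /andP[M_gt0 le_Mp] co k_gt0 T_gt0 ltT lin.
have p_gt0 := prime_gt0 p_pr.
have [M0 p0] : 0 < M%:R :> R /\ 0 < p%:R :> R by rewrite !ltr0n.
have M1 : 1 <= M%:R :> R by rewrite ler1n.
set Me : R := M%:R `^ eps.
have Me_ge1 : 1 <= Me by rewrite -(powRr0 M%:R) ler_powR// ltW.
set X : R := _ / _.
have X_ge0 : 0 <= X by rewrite mulr_ge0 ?invr_ge0 ?powR_ge0.
have div_le n : (0 < n <= 144 * M ^ 8)%N -> (size (divisors n))%:R <= C * G * Me.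
  move=> /andP[n_gt0 n_le]; apply: le_trans (hC _ n_gt0) _.
  rewrite -mulrA ler_wpM2l//; first exact: le_trans C_ge1.
  have -> : Me = (M ^ 8)%:R `^ (eps / 8).
    by rewrite natrX -powR_mulrn// -powRrM; congr (_ `^ _); field.
  by rewrite -powRM// -natrM ge0_ler_powR ?nnegrE ?ler_nat// ltW.
have EMe : E * Me = 2 * (C * G * Me) + 2 * Me by rewrite /E; ring.
suff le_I2 : (I2 p lambda M K L)%:R <= 20 * E * (X + Me).
  apply: le_lt_trans le_I2 _; rewrite ltr_pM2r; last by lra.
  by rewrite ltrDl.
have [s [s_uniq sP ->]] := I2_size p M lambda K L.
have [M_small|M_large] := ltnP (4 * M ^ 4) p.
  have E_le : E * Me <= 20 * E * (X + Me).
    by rewrite -[leLHS]mul1r -[leRHS]mulrA ler_pM// ?ler_wpM2l ?mulr_ge0 /E; lra.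
  apply: le_trans E_le.
  have [s_le2|[n /andP[n_gt0 n_le] s_le]] :=
    small_box_size p_pr le_Mp co M_small s_uniq sP.
    apply: (@le_trans _ _ 2); first by rewrite (ler_nat R _ 2).
    by rewrite -[leLHS]mulr1 ler_pM// /E; lra.
  apply: (@le_trans _ _ (2 * (size (divisors n))%:R)); first by rewrite -natrM ler_nat.
  apply: (@le_trans _ _ (2 * (C * G * Me))).
    rewrite ler_wpM2l// div_le// n_gt0 (leq_trans n_le)//.
    by apply: (@leq_trans (M ^ 8)); rewrite ?leq_pmull// leq_pexp2l.
  by rewrite EMe lerDl; lra.
case: s s_uniq sP => [|P0 s]; first by move=> _ _; rewrite mulr_ge0// /E; lra.
set s1 := P0 :: s => s_uniq sP.
have h0 : hyperbola_points p lambda M K L P0 by apply: sP; rewrite inE eqxx.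
have [t [u [v [t_gt0 tTM [dv vT] [du uT]]]]] := lin _ h0.
pose D := Num.truncn (C * G * Me).
have D_le : D%:R <= C * G * Me.
  by rewrite truncn_le mulr_ge0 ?(le_trans _ Me_ge1)//; lra.
have leD n : (0 < n <= 9 * p ^ 2)%N -> (size (divisors n) <= D)%N.
  move=> /andP[n_gt0 n_le]; rewrite truncn_ge_nat; last by apply: le_trans D_le.
  apply: div_le; rewrite n_gt0 (leq_trans n_le)//.
  have : (p ^ 2 <= (4 * M ^ 4) ^ 2)%N by rewrite leq_exp2r.
  by rewrite expnMn -expnM -(leq_pmul2l (isT : 0 < 9)%N) mulnA.
have := large_box_size p_pr le_Mp co s_uniq sP h0 t_gt0 T_gt0 tTM dv vT du uT leD.
rewrite -(ler_nat R) => /le_trans -> //.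
rewrite natrM [X in X * _]natrD [X in _ * X]natrD [(2 * D)%:R]natrM [(_ * 2)%:R]natrM.
pose Y : R := M%:R / T%:R.
have T0 : 0 < T%:R :> R by rewrite ltr0n.
have Z_le : (5 * M %/ T)%:R <= 5 * Y.
  by rewrite /Y mulrA ler_pdivlMr// -!natrM ler_nat leq_divM.
have Y_le : Y * Me <= 2 * X.
  have root : p%:R `^ k%:R^-1 <= 2 * T%:R * M%:R `^ k%:R^-1 :> R.
    have : p%:R `^ k%:R^-1 <= ((2 * T) ^ k * M)%:R `^ k%:R^-1 :> R.
      by rewrite ge0_ler_powR ?nnegrE ?invr_ge0// ler_nat ltnW.
    rewrite natrM powRM// natrX -powR_mulrn// -powRrM mulfV ?powRr1 ?natrM//.
    by rewrite pnatr_eq0 -lt0n.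
  rewrite /X powRD ?(gt_eqF M0) ?implybT// powRD ?(gt_eqF M0) ?implybT// powRr1 ?(ltW M0)//.
  rewrite -/Me [leRHS]mulrA ler_pdivlMr ?powR_gt0//.
  have -> : Y * Me * p%:R `^ k%:R^-1 = M%:R * Me * p%:R `^ k%:R^-1 / T%:R.
    by rewrite /Y; ring.
  rewrite ler_pdivrMr//.
  have -> : 2 * (M%:R * M%:R `^ k%:R^-1 * Me) * T%:R
      = M%:R * Me * (2 * T%:R * M%:R `^ k%:R^-1) :> R by ring.
  by rewrite ler_wpM2l// mulr_ge0// ?powR_ge0.
apply: (@le_trans _ _ ((5 * Y * 2 + 1) * (E * Me))).
  apply: ler_pM => //.
  - by rewrite lerD2r ler_wpM2r.
  - by rewrite EMe lerD//; [rewrite ler_wpM2l|lra].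
have -> : (5 * Y * 2 + 1) * (E * Me) = E * (10 * (Y * Me) + Me) by ring.
have -> : 20 * E * (X + Me) = E * (20 * (X + Me)) by ring.
rewrite ler_wpM2l//; first by rewrite /E; lra.
by lra.
Qed.

Theorem theorem1 (R : realType) (eps : R) (eps_gt0 : 0 < eps) :
  exists (p0 : nat) (c : R), 0 < c /\
    forall (p : nat) (M : nat) (lambda K L : int),
      prime p -> (p0 <= p)%N -> (1 <= M <= p)%N -> coprimez lambda p%:Z ->
      (I2 p lambda M K L)%:R <
        c * (M%:R `^ (4 / 3 + eps) / p%:R `^ (1 / 3) + M%:R `^ eps) /\
      (I2 p lambda M L L)%:R <
        c * (M%:R `^ (3 / 2 + eps) / p%:R `^ (1 / 2) + M%:R `^ eps).
Proof.
have [c c_gt0 hc] := I2_lt_of_linearizing eps_gt0.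
exists 0%N, c; split => // p M lambda K L p_pr _ Mp co.
have p_gt0 := prime_gt0 p_pr.
split.
- have -> : 4 / 3 = 1 + 3^-1 :> R by lra.
  rewrite div1r; have [T T_gt0 /andP[T_le T_gt]] := root_floor (isT : 0 < 3)%N Mp.
  apply: (hc p M lambda K L 3 T) => // P0 _.
  pose a (b : bool) := if b then P0.1 else P0.2.
  have [t [/andP[t_gt0 t_le] ht]] := dirichlet_approximation a p_gt0 T_gt0.
  rewrite card_bool in t_le; have [v dv vT] := ht true; have [u du uT] := ht false.
  exists t, u, v; split => //; last by split => //; clear -uT; lia.
    apply: leq_trans T_le; rewrite leq_mul2r; apply/orP; right.
    by rewrite (expnSr T 2) leq_mul2r t_le orbT.
  by split => //; clear -vT; lia.
- have -> : 3 / 2 = 1 + 2^-1 :> R by lra.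
  rewrite div1r; have [T T_gt0 /andP[T_le T_gt]] := root_floor (isT : 0 < 2)%N Mp.
  apply: (hc p M lambda L L 2 T) => // P0 [_ x_in y_in].
  have [t [/andP[t_gt0 t_le] /(_ tt)[u du uT]]] :=
    dirichlet_approximation (fun _ : unit => L) p_gt0 T_gt0.
  rewrite card_unit expn1 in t_le.
  have tTM : (t * T * M <= p)%N.
    by apply: leq_trans T_le; rewrite leq_mul2r leq_mul2r t_le !orbT.
  have shift x : L + 1 <= x <= L + M%:Z ->
      (p %| t%:Z * x - (u + t%:Z * (x - L)))%Z /\
      `|u + t%:Z * (x - L)| * T%:Z <= 2 * p%:Z.
    move=> x_in'; split.
      by apply: etrans du; congr (_ %| _)%Z; ring.
    have -> : 2 * p%:Z = p%:Z + p%:Z by lia.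
    have -> : `|u + t%:Z * (x - L)| * T%:Z = `|u * T%:Z + t%:Z * T%:Z * (x - L)|.
      by rewrite -[T%:Z in LHS]gez0_abs// -normrM; congr `|_|; ring.
    apply: ler_normDD; first by rewrite normrM.
    have xM : `|x - L| <= M%:Z by lia.
    by apply: le_trans (ler_normM (lexx _) xM) _; rewrite -PoszM ger0_norm.
  by exists t, (u + t%:Z * (P0.2 - L)), (u + t%:Z * (P0.1 - L)); split=> //; apply: shift.
Qed.
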